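(* Let $U$ and $Y$ be isomorphic Banach spaces, let $D\subseteq U$ be open, and let $F:D\to Y$ be continuously Fréchet differentiable. Suppose there exist $u_1^*,u_2^*\in D$ with $F(u_1^* )=F(u_2^* )=0$ and $u_1^*\neq u_2^*$. Let $E_1$ be an open bounded convex set with $E_1\subset D\setminus\{u_2^*\}$ and $u_1^*\in E_1$, and let $E_2$ be an open bounded convex set with $E_2\subset D\setminus\{u_1^*\}$ and $u_2^*\in E_2$. Let $M(\cdot;u_1^* ):D\setminus\{u_1^*\}\to GL(Y,Y)$ be a deflation operator, and suppose there are constants $\omega_1^*,\omega_2^*,\omega_{M'}>0$ such that: (i) $F'(u_1^* )^{-1}$ and $F'(u_2^* )^{-1}$ exist; (ii) $\|F'(u_1^* )^{-1}(F'(u)-F'(v))\|\le \omega_1^*\|u-v\|$ for all $u,v\in E_1$; (iii) $\|F'(u_2^* )^{-1}(F'(u)-F'(v))\|\le \omega_2^*\|u-v\|$ for all $u,v\in E_2$; (iv) $M(u;u_1^* )$ is continuously Fréchet differentiable (with respect to $u$) for all $u\in E_2$; (v) $\|M'(u;u_1^* )-M'(v;u_1^* )\|\le \omega_{M'}\|u-v\|$ for all $u,v\in E_2$. Write $G(u)=M(u;u_1^* )F(u)$ for $u \in D\setminus\{u_1^*\}$. Then there exists $\tilde\omega_2>0$ such that for all $u,v\in E_2$ $$\left\|G'(u_2^* )^{-1}\left[G'(u)-G'(v)\right]\right\|\le\tilde\omega_2\|u-v\|.$$ Let $\tilde\omega_2$ be such a constant. If $\|u_1^*-u_2^*\|<\rho_1+\rho_2$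 for some $\rho_1\le 2/(3\omega_1^* )$ and $\rho_2\le 2/(3\tilde\omega_2)$ such that $B_1=B(u_1^*,\rho_1)\subset E_1$ and $B_2=B(u_2^*,\rho_2)\subset E_2$, then $B_1\cap B_2$ is nonempty, and for every $u_0\in B_1\cap B_2$, Newton's method applied to $F$ from $u_0$ converges to $u_1^*\in E_1$, and Newton's method applied to the deflated function $G$ from the same initial guess $u_0$ converges to $u_2^*\in E_2$.
   Context: $B(c,\rho)$ denotes the open ball of centre $c$ and radius $\rho$ in $U$. $GL(Y,Y)$ denotes the set of bounded invertible linear operators on $Y$. A prime denotes the Fréchet derivative with respect to $u$; operator norms are the induced ones. Newton's method applied to a Fréchet differentiable map $H$ from $u_0$ generates the sequence $u_{k+1}=u_k-H'(u_k)^{-1}H(u_k)$; convergence includes that the sequence is well-defined. Deflation operator: given a solution $u_1^*$ of $F(u)=0$, a deflation operator $M(\cdot;u_1^* )$ assigns to each $u\neq u_1^*$ an element $M(u;u_1^* )\in GL(Y,Y)$; it is used to form the deflated residual $G(u)=M(u;u_1^* )F(u)$, and (when $F'(u_1^* )$ is nonsingular) it has the properties that for $u\ne u_1^*$, $G(u)=0$ if and only if $F(u)=0$, and that $\liminf_{u\to u_1^*}\|G(u)\|>0$. An example is $M(u;u_1^* )=\left(\|u-u_1^*\|^{-p}+\sigma\right)\mathbb{I}$ with $\mathbb{I}$ the identity on $Y$, power $p$ and shift $\sigma$ (e.g. $p=2$, $\sigma=1$). *)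

(* Defs.v *)
From HB Require Import structures.
From mathcomp Require Import all_boot all_order all_algebra.
From mathcomp Require Import all_classical all_reals all_analysis.

Set Implicit Arguments.
Unset Strict Implicit.
Unset Printing Implicit Defensive.

Import Order.TTheory GRing.Theory Num.Theory.
Import numFieldNormedType.Exports.

Local Open Scope classical_set_scope.
Local Open Scope ring_scope.

Section BoundedOperatorPred.
Context {R : realType} {U V : normedModType R}.

Definition bop_pred : {pred (U -> V)} :=
  [pred f : U -> V | `[< linear f /\ continuous f >]].

Lemma bop_predP (f : U -> V) : f \in bop_pred <-> linear f /\ continuous f.
Proof. by split=> [/asboolP//|?]; apply/asboolP. Qed.

Lemma bop_submod_closed : submod_closed bop_pred.
Proof.
split=> [|k f g /bop_predP[fl fc] /bop_predP[gl gc]].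
  apply/bop_predP; split=> [a x y|x]; last exact: cvg_cst.
  by rewrite [LHS]/= /GRing.zero /= scaler0 addr0.
apply/bop_predP; split=> [a x y|x].
  rewrite -![(k *: f + g) _]/(k *: f _ + g _) fl gl !scalerDr !scalerA.
  by rewrite (mulrC k) -!addrA; congr (_ + _); rewrite addrCA.
by apply: cvgD; [apply: cvgZr; exact: fc|exact: gc].
Qed.

End BoundedOperatorPred.

HB.instance Definition _ (R : realType) (U V : normedModType R) :=
  GRing.isSubmodClosed.Build R (U -> V) (@bop_pred R U V)
    (@bop_submod_closed R U V).

Record bounded_operator (R : realType) (U V : normedModType R) := BoundedOperator {
  bop_fun :> U -> V ;
  bop_funP : bop_fun \in @bop_pred R U V }.

Section BoundedOperator.
Context {R : realType} {U V : normedModType R}.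
Local Notation L := (bounded_operator U V).

HB.instance Definition _ := [isSub for @bop_fun R U V].
HB.instance Definition _ := gen_eqMixin L.
HB.instance Definition _ := [Choice of L by <:].
HB.instance Definition _ := [SubChoice_isSubLmodule of L by <:].

Lemma bop_linear (A : L) : linear A.
Proof. by have /bop_predP[] := bop_funP A. Qed.

Lemma bop_continuous (A : L) : continuous A.
Proof. by have /bop_predP[] := bop_funP A. Qed.

HB.instance Definition _ (A : L) :=
  GRing.isLinear.Build R U V _ (bop_fun A) (bop_linear A).

Lemma bopP (A B : L) : A =1 B -> A = B.
Proof. by move=> AB; apply/val_inj/funext. Qed.

Lemma bop0E x : (0 : L) x = 0. Proof. by []. Qed.
Lemma bopDE (A B : L) x : (A + B) x = A x + B x. Proof. by []. Qed.
Lemma bopZE k (A : L) x : (k *: A) x = k *: A x. Proof. by []. Qed.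

Definition opnorm (A : L) : R := sup [set `|A x| | x in [set x | `|x| <= 1]].

Lemma opnorm_has_sup (A : L) : has_sup [set `|A x| | x in [set x | `|x| <= 1]].
Proof.
split; first by exists `|A 0|, 0 => //=; rewrite normr0.
have /linear_boundedP/pinfty_ex_gt0[r r0 rA] : bounded_near A (nbhs (0 : U)).
  by apply/linear_bounded_continuous; exact: bop_continuous.
exists r => _ [x /= x1 <-]; apply: (le_trans (rA x)).
by rewrite -[leRHS]mulr1 ler_wpM2l// ltW.
Qed.

Lemma opnorm_ge0 (A : L) : 0 <= opnorm A.
Proof.
apply: (@le_trans _ _ `|A 0|) => //.
by apply: (sup_upper_bound (opnorm_has_sup A)); exists 0 => //=; rewrite normr0.
Qed.

Lemma ler_opnorm (A : L) x : `|A x| <= opnorm A * `|x|.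
Proof.
have [->|x0] := eqVneq x 0; first by rewrite linear0 !normr0 mulr0.
have nx0 : 0 < `|x| by rewrite normr_gt0.
rewrite -ler_pdivrMr// mulrC -[X in X * _](ger0_norm (ltW _)) ?invr_gt0//.
rewrite -normrZ -linearZ; apply: (sup_upper_bound (opnorm_has_sup A)).
by exists (`|x|^-1 *: x) => //=; rewrite normrZ gtr0_norm ?invr_gt0// mulVf ?gt_eqF.
Qed.

Lemma opnorm_le (A : L) (r : R) :
  (forall x, `|x| <= 1 -> `|A x| <= r) -> opnorm A <= r.
Proof.
move=> Ar; apply: ge_sup; first by case: (opnorm_has_sup A).
by move=> _ [x /= /Ar ? <-].
Qed.

Lemma ler_opnormD (A B : L) : opnorm (A + B) <= opnorm A + opnorm B.
Proof.
apply: opnorm_le => x x1; apply: (le_trans (ler_normD _ _)); apply: lerD.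
- by apply: (le_trans (ler_opnorm A x)); rewrite ler_piMr ?opnorm_ge0.
- by apply: (le_trans (ler_opnorm B x)); rewrite ler_piMr ?opnorm_ge0.
Qed.

Lemma opnormZ k (A : L) : opnorm (k *: A) = `|k| * opnorm A.
Proof.
have le l (B : L) : opnorm (l *: B) <= `|l| * opnorm B.
  apply: opnorm_le => x x1; rewrite bopZE normrZ ler_wpM2l//.
  by apply: (le_trans (ler_opnorm B x)); rewrite ler_piMr ?opnorm_ge0.
apply/eqP; rewrite eq_le le /=.
have [->|k0] := eqVneq k 0; first by rewrite normr0 mul0r opnorm_ge0.
have := le k^-1 (k *: A); rewrite scalerA mulVf// scale1r normfV.
by rewrite ler_pdivlMl ?normr_gt0.
Qed.

Lemma opnorm0_eq0 (A : L) : opnorm A = 0 -> A = 0.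
Proof.
move=> A0; apply: bopP => x; apply/eqP; rewrite -normr_le0.
by rewrite (le_trans (ler_opnorm A x))// A0 mul0r.
Qed.

HB.instance Definition _ :=
  Lmodule_isNormed.Build R L ler_opnormD opnormZ opnorm0_eq0.

Lemma bop_normE (A : L) : `|A| = opnorm A. Proof. by []. Qed.

End BoundedOperator.

Section Composition.
Context {R : realType} {U V W : normedModType R}.

Lemma bop_comp_subproof (B : bounded_operator V W) (A : bounded_operator U V) :
  (B \o A) \in @bop_pred R U W.
Proof.
apply/bop_predP; split=> [a x y|x]; first by rewrite /= !linearP.
by apply: continuous_comp; exact: bop_continuous.
Qed.

Definition bop_comp B A : bounded_operator U W :=
  BoundedOperator (bop_comp_subproof B A).

End Composition.

Section Inverse.
Context {R : realType} {U V : normedModType R}.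

Definition bop_invertible (A : bounded_operator U V) : Prop :=
  exists B : bounded_operator V U, cancel A B /\ cancel B A.

(* 0 when A is not invertible. *)
Definition bop_inv (A : bounded_operator U V) : bounded_operator V U :=
  xget 0 [set B : bounded_operator V U | cancel A B /\ cancel B A].

Lemma bop_invP (A : bounded_operator U V) :
  bop_invertible A -> cancel A (bop_inv A) /\ cancel (bop_inv A) A.
Proof. by case=> B AB; rewrite /bop_inv; case: xgetP => [C ->//|/(_ B)]. Qed.

End Inverse.

Section FrechetDerivative.
Context {R : realType} {U V : normedModType R}.

(* The library's differential 'd f u as an element of L(U, V); differentiable
   includes its continuity, and 0 is a default value when 'd f u is unbounded. *)
Definition frechet (f : U -> V) (u : U) : bounded_operator U V :=
  insubd (0 : bounded_operator U V) ('d f u : U -> V).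

Lemma frechetE (f : U -> V) (u : U) :
  differentiable f u -> frechet f u = 'd f u :> (U -> V).
Proof.
move=> fu; rewrite /frechet /insubd insubT//=; apply/bop_predP.
by split; [exact: linearP|exact: diff_continuous].
Qed.

Definition continuously_differentiable_on (D : set U) (f : U -> V) : Prop :=
  (forall u, D u -> differentiable f u) /\
  {in D, continuous (frechet f)}.

End FrechetDerivative.

Section Deflation.
Context {R : realType} {U Y : normedModType R}.

Definition deflation_operator (D : set U) (F : U -> Y) (r : U)
    (M : U -> bounded_operator Y Y) : Prop :=
  (forall u, (D `\ r) u -> bop_invertible (M u)) /\
  (bop_invertible (frechet F r) ->
    (forall u, (D `\ r) u -> (M u (F u) = 0 <-> F u = 0)) /\
    (0 < limf_einf (fun u => `|M u (F u)|%:E) r^')%E).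

End Deflation.

Section Newton.
Context {R : realType} {U Y : normedModType R}.

Definition newton_seq (H : U -> Y) (u0 : U) (k : nat) : U :=
  iter k (fun u => u - bop_inv (frechet H u) (H u)) u0.

(* D is the domain of H; the first conjunct is well-definedness. *)
Definition newton_converges (D : set U) (H : U -> Y) (u0 l : U) : Prop :=
  (forall k, let u := newton_seq H u0 k in
    [/\ D u, differentiable H u & bop_invertible (frechet H u)]) /\
  newton_seq H u0 @ \oo --> l.

End Newton.

(* Main.v *)
(* For a map H with H z = 0 whose affinely normalised derivative
   H'(z)^-1 H'(u) is w-Lipschitz on the ball of radius rho <= 2/(3w) about z,
   an iterate at distance e < rho has H'(z)^-1 H'(u) within w e < 2/3 of the
   identity, so H'(u) is invertible, and the Newton step multiplies the error by
   at most w e / (2 (1 - w e)) < 1; hence Newton's method converges from the whole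
   ball.  Applied to F at u1 and to G = M F at u2, this gives convergence from the
   same u0 to both roots as soon as the two balls meet.  On the bounded convex E2,
   F, F', M and M' are all bounded and Lipschitz, hence so is
   G' = M' F + M F', and G'(u2) = M(u2) F'(u2) is invertible because F(u2) = 0. *)
Require Import Defs.
From HB Require Import structures.
From mathcomp Require Import all_boot all_order all_algebra.
From mathcomp Require Import all_classical all_reals all_analysis.
From mathcomp Require Import ring lra.

Set Implicit Arguments.
Unset Strict Implicit.
Unset Printing Implicit Defensive.

Import Order.TTheory GRing.Theory Num.Theory.
Import numFieldNormedType.Exports.

Local Open Scope classical_set_scope.
Local Open Scope ring_scope.

(** * Mean value inequality with a scalar majorant *)

(** Continuous induction on [0, 1], free of integrals. A slack [e * t] is granted to the majorant;
    if [phi 1] were positive, the last time [c] with [phi c <= 0] would lie before 1, and a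
    first-order expansion at [c] would produce a later such time. The majorant [psi] is left general
    because both a linear and a quadratic one are needed. *)
Lemma norm_mean_value (R : realType) (V : normedModType R)
    (g g' : R -> V) (psi psi' : R -> R) :
  (forall t : R, 0 <= t <= 1 -> is_derive t 1 g (g' t)) ->
  (forall t : R, 0 <= t <= 1 -> is_derive t 1 psi (psi' t)) ->
  (forall t : R, 0 <= t <= 1 -> `|g' t| <= psi' t) ->
  `|g 1 - g 0| <= psi 1 - psi 0.
Proof.
move=> dg dpsi g'psi'; apply/ler_addgt0Pr => e e0.
pose phi t := `|g t - g 0| - (psi t - psi 0) - e * t.
suff : phi 1 <= 0 by rewrite /phi; lra.
rewrite leNgt; apply/negP => phi1.
have ct t : 0 <= t <= 1 -> {for t, continuous phi}.
  move=> t01.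
  have cg : {for t, continuous g}.
    by apply/differentiable_continuous/derivable1_diffP; have [] := dg _ t01.
  have cpsi : {for t, continuous psi}.
    by apply/differentiable_continuous/derivable1_diffP; have [] := dpsi _ t01.
  apply: cvgB; last by apply: cvgMr; exact: cvg_id.
  apply: cvgB; last by apply: cvgB => //; exact: cvg_cst.
  by apply: cvg_norm; apply: cvgB => //; exact: cvg_cst.
pose S := [set t | 0 <= t <= 1 /\ phi t <= 0].
have S0 : S 0 by split; rewrite ?lexx ?ler01// /phi !subrr normr0; lra.
have supS : has_sup S by split; [exists 0|exists 1 => t [/andP[]]].
pose c := sup S.
have c01 : 0 <= c <= 1.
  apply/andP; split; first exact: (sup_upper_bound supS).
  by apply: ge_sup; [exists 0|move=> t [/andP[]]].
(* The supremum belongs to [S]: positivity of [phi] at [c] would persist nearby, while [S]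
   accumulates at [c] from the left. *)
have phic : phi c <= 0.
  rewrite leNgt; apply/negP => phic.
  have : \forall t \near c, 0 < phi t by apply: (cvgr_gt _ (ct _ c01)).
  move=> /nbhs_ballP[d /= d0 dc].
  have [s Ss cs] := sup_adherent d0 supS.
  have sc : s <= c by exact: (sup_upper_bound supS).
  have /dc /= : ball c d s.
    by rewrite /ball/= ger0_norm ?subr_ge0//; move: cs; rewrite -/c; lra.
  by case: Ss => _; lra.
have c1 : c < 1.
  case/andP: c01 => _; rewrite le_eqVlt => /orP[/eqP cE|//].
  by move: phi1; rewrite -cE; lra.
have posc t : c < t -> t <= 1 -> 0 < phi t.
  move=> ct1 t1; rewrite ltNge; apply/negP => phit.
  have : t <= c.
    apply: (sup_upper_bound supS); split => //.
    by case/andP: c01 => ? _; apply/andP; split; lra.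
  lra.
(* Used once for [g] and once for [psi]: the two errors [e / 2 * h] add up to exactly the slack
   [e * h] that [phi] gains over a step [h]. *)
have slope (W : normedModType R) (f : R -> W) (l : W) :
    is_derive c (1 : R) f l -> exists2 d, 0 < d &
    forall h, 0 < h < d -> `|f (h + c) - f c - h *: l| <= e / 2 * h.
  move=> [df <-].
  have /cvgrPdist_le/(_ (e / 2)) :
    (fun h => h^-1 *: ((f \o shift c) (h *: (1:R)) - f c)) @ 0^'
      --> 'D_1 f c by exact: df.
  have e20 : 0 < e / 2 by lra.
  move=> /(_ e20) /nbhs_ballP[d /= d0 dP]; exists d => // h /andP[h0 hd].
  have /dP : ball (0 : R) d h by rewrite /ball/= sub0r normrN gtr0_norm.
  move=> /(_ (lt0r_neq0 h0)); rewrite /= [_ *: 1]mulr1 distrC => hP.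
  have -> : f (h + c) - f c - h *: 'D_1 f c =
      h *: (h^-1 *: (f (h + c) - f c) - 'D_1 f c).
    by rewrite scalerBr scalerA mulfV ?gt_eqF// scale1r.
  by rewrite normrZ gtr0_norm// mulrC ler_pM2r.
have [d d0 gd] := slope _ _ _ (dg _ c01).
have [d' d'0 psid] := slope _ _ _ (dpsi _ c01).
(* Halving makes [h] strictly smaller than [d] and [d']; the term [1 - c] keeps [h + c] inside
   [0, 1]. *)
pose h := Num.min (Num.min d d') (1 - c) / 2.
have hP : [/\ 0 < h, h < d, h < d' & h <= 1 - c].
  rewrite /h; have : 0 < Num.min (Num.min d d') (1 - c).
    by rewrite !lt_min d0 d'0 subr_gt0.
  have : Num.min (Num.min d d') (1 - c) <= d by rewrite !ge_min lexx.
  have : Num.min (Num.min d d') (1 - c) <= d' by rewrite !ge_min lexx orbT.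
  have : Num.min (Num.min d d') (1 - c) <= 1 - c.
    by rewrite !ge_min lexx orbT.
  by move: (Num.min _ _) => m *; split; lra.
case: hP => h0 hd hd' hc.
have := gd h; rewrite h0 hd => /(_ isT) {}gd.
have := psid h; rewrite h0 hd' => /(_ isT) {}psid.
(* The expansions give [phi (h + c) <= phi c <= 0], which contradicts this. *)
have : 0 < phi (h + c) by apply: posc; lra.
have : `|g (h + c) - g 0| <= `|g c - g 0| + h * psi' c + e / 2 * h.
  have := ler_normD (g (h + c) - g c) (g c - g 0); rewrite subrKA => gg.
  have := ler_normD (g (h + c) - g c - h *: g' c) (h *: g' c); rewrite subrK.
  have : `|h *: g' c| <= h * psi' c.
    by rewrite normrZ gtr0_norm// ler_pM2l// g'psi'.
  lra.
move: psid; rewrite ler_norml => /andP[psid _].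
by move: phic psid; rewrite /phi /GRing.scale/=; nra.
Qed.

(** * Derivative estimates along segments *)

Lemma convex_set_segment (R : realType) (U : normedModType R) (E : set U)
    (u v : U) (t : R) :
  convex_set E -> E u -> E v -> 0 <= t <= 1 -> E (v + t *: (u - v)).
Proof.
move=> cE Eu Ev /andP[t0 t1].
have := cE u v (Itv01 t0 t1) (mem_set Eu) (mem_set Ev); rewrite inE.
congr E; rewrite /conv/= scalerBl scale1r scalerBr.
by rewrite addrC -addrA [- _ + _]addrC.
Qed.

Lemma is_derive_segment (R : realType) (U V : normedModType R) (f : U -> V)
    (z d : U) (t : R) :
  differentiable f (z + t *: d) ->
  is_derive t (1 : R) (fun s => f (z + s *: d)) (frechet f (z + t *: d) d).
Proof.
move=> df; rewrite frechetE//.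
have dl : is_diff t (fun s : R => z + s *: d) (0 + (fun s => s *: d)).
  exact: (@is_diffD _ _ _ (cst z) ( *:%R^~ d : R -> U) 0
            ( *:%R^~ d : R -> U) t _ _).
have dfl := is_diff_comp dl (differentiableP df).
apply: DeriveDef; first exact/diff_derivable.
by rewrite deriveE// diff_val /= add0r scale1r.
Qed.

Lemma bop_norm_comp (R : realType) (U V W : normedModType R)
    (B : bounded_operator V W) (A : bounded_operator U V) :
  `|bop_comp B A| <= `|B| * `|A|.
Proof.
apply: opnorm_le => x x1; apply: (le_trans (ler_opnorm B _)).
rewrite -!bop_normE ler_wpM2l// (le_trans (ler_opnorm A x))// -bop_normE.
by rewrite ler_piMr.
Qed.

Lemma ler_bop_norm (R : realType) (U V : normedModType R)
    (A : bounded_operator U V) (r : R) (x : U) : `|A| <= r -> `|A x| <= r * `|x|.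
Proof. by move=> Ar; apply: (le_trans (ler_opnorm A x)); rewrite ler_wpM2r. Qed.

(** The mean value inequality is applied to [f] on the segment from [v] to [u], with the linear
    majorant [t * (K * |u - v|)]; convexity keeps the segment in [E]. *)
Lemma lipschitz_of_frechet_bound (R : realType) (U V : normedModType R)
    (f : U -> V) (E : set U) (K : R) :
  convex_set E -> (forall u, E u -> differentiable f u) ->
  (forall u, E u -> `|frechet f u| <= K) ->
  forall u v, E u -> E v -> `|f u - f v| <= K * `|u - v|.
Proof.
move=> cE df fK u v Eu Ev.
have Ev_ t : 0 <= t <= 1 -> E (v + t *: (u - v)) by exact: convex_set_segment.
have := @norm_mean_value R V (fun t => f (v + t *: (u - v))) _
  (fun t : R => t *: (K * `|u - v| : R)) (fun _ => K * `|u - v|).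
rewrite !scale1r !scale0r addr0 subr0 [v + _]addrC subrK; apply => t t01.
- exact/is_derive_segment/df/Ev_.
- have := @is_diff_scalel R R t (K * `|u - v|) => dl.
  apply: DeriveDef; first exact/diff_derivable.
  by rewrite deriveE// diff_val scale1r.
- exact/ler_bop_norm/fK/Ev_.
Qed.

(* The constant 1/2, obtained from the mean value inequality with majorant
   t - t^2/2, is what makes the radius 2/(3w) admissible. *)
Lemma newton_linearization_error (R : realType) (U Y : normedModType R)
    (H : U -> Y) (B : bounded_operator Y U) (z u : U) (w : R) :
  (forall t : R, 0 <= t <= 1 -> differentiable H (z + t *: (u - z))) ->
  (forall t : R, 0 <= t <= 1 ->
    `|bop_comp B (frechet H u - frechet H (z + t *: (u - z)))|
      <= w * `|u - (z + t *: (u - z))|) ->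
  `|B (frechet H u (u - z)) - B (H u - H z)| <= w / 2 * `|u - z| ^+ 2.
Proof.
move=> dH Hw; set d := u - z.
pose b := B (frechet H u d).
have dB x : is_diff x B B.
  have cB := @bop_continuous _ _ _ B.
  by apply: DiffDef; [exact: linear_differentiable|exact: diff_lin].
(* The derivative of this path is [B (H'(u) - H'(z + t d)) d], of norm at most [w (1 - t) |d|^2]
   since [u - (z + t d) = (1 - t) d]. The increment of the path over [0, 1] is the quantity to be
   bounded. *)
have := @norm_mean_value R U (fun t => t *: b - B (H (z + t *: d)))
  (fun t => b - B (frechet H (z + t *: d) d))
  (fun t : R => (w * `|d| ^+ 2) * (t - t ^+ 2 / 2))
  (fun t : R => (w * `|d| ^+ 2) * (1 - t)).
rewrite !scale1r !scale0r addr0 sub0r opprK [z + d]addrC subrK.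
rewrite -addrA [- _ + _]addrC -opprB -linearB => /(_ _ _ _)/le_trans; apply.
- move=> t t01.
  have dl := @is_diff_scalel R U t b.
  have db : is_derive t (1 : R) (fun s : R => s *: b) b.
    apply: DeriveDef; first exact/diff_derivable.
    by rewrite deriveE// diff_val scale1r.
  have dBH : differentiable (B \o H) (z + t *: d).
    by apply: differentiable_comp; [exact: dH|exact: ex_diff].
  have := is_derive_segment dBH.
  rewrite frechetE// diff_comp//; last exact: dH.
  rewrite diff_val -frechetE; last exact: dH.
  by move=> dBs; apply: is_deriveB.
- move=> t _; apply: is_derive_eq.
  by rewrite /GRing.scale/=; congr (_ * _); rewrite !mulr0 !mulr1; lra.
- move=> t t01; have /andP[t0 t1] := t01.
  have := ler_bop_norm d (Hw t t01).
  have -> : bop_comp B (frechet H u - frechet H (z + t *: (u - z))) d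
    = b - B (frechet H (z + t *: d) d) by rewrite /= linearB.
  have -> : u - (z + t *: (u - z)) = (1 - t) *: d.
    by rewrite opprD addrA scalerBl scale1r.
  move=> /le_trans; apply; rewrite normrZ ger0_norm ?subr_ge0//; lra.
by rewrite expr1n expr0n/= mul0r subr0 !mulr0 subr0; lra.
Qed.

(** * Invertibility of operators close to the identity *)

Lemma bopB (R : realType) (U V : normedModType R) (A : bounded_operator U V) x y :
  A (x - y) = A x - A y.
Proof. exact: linearB. Qed.

Lemma bop_invertible_comp (R : realType) (U V W : normedModType R)
    (B : bounded_operator V W) (A : bounded_operator U V) :
  bop_invertible B -> bop_invertible A -> bop_invertible (bop_comp B A).
Proof.
move=> [B' [BK B'K]] [A' [AK A'K]]; exists (bop_comp A' B').
by split=> x /=; rewrite ?BK ?AK ?A'K ?B'K.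
Qed.

Section NeumannPerturbation.
Context {R : realType} {U : completeNormedModType R}.
Variables (T : bounded_operator U U) (q : R).
Hypotheses (q1 : q < 1) (Tq : forall x, `|x - T x| <= q * `|x|).

(** This lower bound serves twice: it yields injectivity and the bound on the inverse below, and it
    later turns an estimate of the image of the Newton error into one of the error itself. *)
Lemma ler_near_id x : (1 - q) * `|x| <= `|T x|.
Proof.
by have := ler_normD (x - T x) (T x); rewrite subrK; have := Tq x; lra.
Qed.

(** A solution is a fixed point of the contraction [x -> y + (x - T x)] of the complete space
    [U]. *)
Lemma near_id_surj y : exists x, T x = y.
Proof.
(* A contraction constant must be nonnegative, whereas [q] carries no sign. *)
have q0 : 0 <= Num.max q 0 by rewrite le_max lexx orbT.
pose f x := y + (x - T x).
have fT : set_fun setT setT f by [].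
pose ff : {fun [set: U] >-> [set: U]} := HB.pack f (isFun.Build _ _ _ _ f fT).
have [||x _ xE] := @banach_fixed_point R U setT ff _ closedT; last 1 first.
- exists x; apply/eqP; move/eqP: xE; rewrite /= /f addrCA -subr_eq0 opprD.
  by rewrite addrA subrr sub0r oppr_eq0 subr_eq0 eq_sym.
- exists (NngNum q0); split=> /=; first by rewrite gt_max q1 ltr01.
  move=> [a b] /= _; rewrite /f opprD addrACA subrr add0r opprD addrACA -opprD.
  by rewrite -bopB; apply: (le_trans (Tq _)); rewrite ler_wpM2r// le_max lexx.
- by exists 0.
Qed.

(** Choice applied to surjectivity gives a right inverse [S]. Injectivity of [T] makes [S] linear
    and two-sided, and the lower bound on [T] bounds [S] by [1 / (1 - q)]. *)
Lemma bop_invertible_near_id : bop_invertible T.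
Proof.
have [S TS] := choice near_id_surj.
have Tinj : injective T.
  move=> x y xy; apply/eqP; rewrite -subr_eq0 -normr_le0.
  have := ler_near_id (x - y); rewrite bopB xy subrr normr0.
  by rewrite pmulr_rle0 ?subr_gt0.
have Slin : linear S by move=> a x y; apply: Tinj; rewrite bop_linear !TS.
pose SL : {linear U -> U} := HB.pack S (GRing.isLinear.Build _ _ _ _ S Slin).
have Scont : continuous S.
  apply/(@linear_bounded_continuous _ _ _ SL)/linear_boundedP.
  exists (1 - q)^-1; split => [|r rq x]; first exact: num_real.
  have q'0 : 0 < 1 - q by rewrite subr_gt0.
  apply: (@le_trans _ _ ((1 - q)^-1 * `|x|)); last by rewrite ler_wpM2r// ltW.
  by rewrite ler_pdivlMl// -{2}(TS x) ler_near_id.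
have Sbop : S \in @bop_pred R U U by apply/bop_predP.
by exists (BoundedOperator Sbop); split=> [x|x] /=; [apply: Tinj|]; rewrite TS.
Qed.

End NeumannPerturbation.

(** * Local convergence of Newton's method *)

Section NewtonConvergence.
Context {R : realType} {U : completeNormedModType R} {Y : normedModType R}.
Variables (H : U -> Y) (z : U) (w rho : R).
Let B := bop_inv (frechet H z).
Hypotheses (w0 : 0 < w) (rho_le : rho <= 2 / (3 * w)) (Hz : H z = 0).
Hypothesis dH : forall u, ball z rho u -> differentiable H u.
Hypothesis Hz_inv : bop_invertible (frechet H z).
Hypothesis H'_lip : forall u v, ball z rho u -> ball z rho v ->
  `|bop_comp B (frechet H u - frechet H v)| <= w * `|u - v|.

Lemma ball_center_segment u t : ball z rho u -> 0 <= t <= 1 ->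
  ball z rho (z + t *: (u - z)).
Proof.
rewrite -!ball_normE /= opprD addrA subrr sub0r normrN normrZ distrC.
move=> zu /andP[t0 t1]; apply: le_lt_trans zu.
by rewrite ger0_norm// ler_piMl.
Qed.

Let ball_error u : ball z rho u ->
  [/\ ball z rho z, w * `|u - z| < 2 / 3 & `|u - z| < rho].
Proof.
move=> zu; have uz : `|u - z| < rho by move: zu; rewrite -ball_normE /= distrC.
split=> //.
  by rewrite -ball_normE/= subrr normr0; apply: le_lt_trans uz.
move: rho_le; rewrite ler_pdivlMr; last by rewrite mulr_gt0.
by have := normr_ge0 (u - z); nra.
Qed.

(** Since [B] inverts [H'(z)], the left side is [B (H'(z) - H'(u)) x], to which the Lipschitz
    hypothesis applies with the centre as one of the two points. *)
Lemma affine_newton_operator u x : ball z rho u ->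
  `|x - bop_comp B (frechet H u) x| <= w * `|u - z| * `|x|.
Proof.
move=> zu; have [zz _ _] := ball_error zu.
have := ler_bop_norm x (H'_lip zz zu); rewrite [`|z - u|]distrC.
suff -> : bop_comp B (frechet H z - frechet H u) x =
    x - bop_comp B (frechet H u) x by [].
rewrite -[LHS]/(B (frechet H z x - frechet H u x)) bopB.
by congr (_ - _); exact: (bop_invP Hz_inv).1.
Qed.

(** [H'(u)] factors as [H'(z)] after [B H'(u)], and the second factor is within 2/3 of the
    identity. *)
Lemma newton_frechet_invertible u : ball z rho u -> bop_invertible (frechet H u).
Proof.
move=> zu; have [_ wu _] := ball_error zu.
have iBH : bop_invertible (bop_comp B (frechet H u)).
  apply: (@bop_invertible_near_id _ _ _ (w * `|u - z|)); first by lra.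
  by move=> x; exact: affine_newton_operator.
suff -> : frechet H u = bop_comp (frechet H z) (bop_comp B (frechet H u)).
  exact: bop_invertible_comp.
by apply: bopP => x; exact/esym/(bop_invP Hz_inv).2.
Qed.

Let step u := u - bop_inv (frechet H u) (H u).

(** Applying [B H'(u)] to the new error removes the inverse in the Newton step and leaves the
    linearization error of [H] between [z] and [u]. The factor [1 - w * |u - z|] is the lower bound
    for [B H'(u)]. *)
Lemma newton_step_error u : ball z rho u ->
  (1 - w * `|u - z|) * `|step u - z| <= w / 2 * `|u - z| ^+ 2.
Proof.
move=> zu; have [zz wu _] := ball_error zu.
apply: le_trans (ler_near_id (fun x => affine_newton_operator x zu) _) _.
have -> : bop_comp B (frechet H u) (step u - z) =
    B (frechet H u (u - z)) - B (H u - H z).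
  rewrite -bopB; congr (bop_fun B _); rewrite Hz subr0 /step addrAC bopB.
  by congr (_ - _); exact: (bop_invP (newton_frechet_invertible zu)).2.
by apply: newton_linearization_error => t t01; [apply: dH|apply: H'_lip => //];
  exact: ball_center_segment.
Qed.

Lemma newton_local_convergence (D : set U) u0 :
  ball z rho `<=` D -> ball z rho u0 -> newton_converges D H u0 z.
Proof.
move=> zD zu0; have [zz wu0 u0rho] := ball_error zu0.
(* The contraction factor at the starting point, less than 1 exactly because [w * |u0 - z| < 2 / 3].
   It increases with the error, so it also bounds the factor at every later iterate, where the error
   is no larger. *)
pose c := w * `|u0 - z| / 2 / (1 - w * `|u0 - z|).
have e0 : 0 <= w * `|u0 - z| by rewrite mulr_ge0// ltW.
have c0 : 0 <= c by rewrite /c !divr_ge0//; lra.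
have c1 : c < 1 by rewrite /c ltr_pdivrMr; lra.
have err k : `|newton_seq H u0 k - z| <= c ^+ k * `|u0 - z|.
  elim: k => [|k IH]; first by rewrite expr0 mul1r.
  set u := newton_seq H u0 k in IH *; rewrite [newton_seq H u0 k.+1]/(step u).
  have uu0 : `|u - z| <= `|u0 - z|.
    by apply: le_trans IH _; rewrite ler_piMl// exprn_ile1// ltW.
  have zu : ball z rho u.
    by rewrite -ball_normE /= distrC; exact: le_lt_trans uu0 u0rho.
  have st := newton_step_error zu.
  apply: (@le_trans _ _ (c * `|u - z|)); last by rewrite exprS -mulrA ler_wpM2l.
  rewrite /c mulrAC ler_pdivlMr; last by lra.
  have wuu0 : w * `|u - z| <= w * `|u0 - z| by rewrite ler_pM2l.
  have := normr_ge0 (u - z); have := normr_ge0 (step u - z); nra.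
have zk k : ball z rho (newton_seq H u0 k).
  rewrite -ball_normE /= distrC; apply: le_lt_trans u0rho.
  by apply: le_trans (err k) _; rewrite ler_piMl// exprn_ile1// ltW.
split=> [k /=|].
  by split; [exact: zD|exact: dH|exact: newton_frechet_invertible].
apply/subr_cvg0/norm_cvg0P.
apply: (@squeeze_cvgr _ _ _ _ (cst 0) (fun k => c ^+ k * `|u0 - z|)).
- by apply: nearW => k; rewrite normr_ge0 err.
- exact: cvg_cst.
- rewrite -[X in _ --> X](mul0r `|u0 - z|); apply: cvgMl.
  by apply: cvg_expr; rewrite ger0_norm.
Qed.

End NewtonConvergence.

(** * The product rule for an operator-valued map applied to a vector-valued map *)

Section OperatorApplication.
Context {R : realType} {Y V : normedModType R}.

(** Evaluation gets a name so that it can carry a bilinear structure; the product rule then comes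
    from the differential of a continuous bilinear map and the chain rule. *)
Definition bop_apply (A : bounded_operator Y V) (y : Y) : V := A y.

Lemma bop_apply_bilinear :
  bilinear_for (GRing.Scale.Law.clone _ _ *:%R _)
    (GRing.Scale.Law.clone _ _ *:%R _) bop_apply.
Proof. by split=> [y|A] a x y' //=; exact: bop_linear. Qed.

HB.instance Definition _ :=
  bilinear_isBilinear.Build R _ _ _ _ _ bop_apply bop_apply_bilinear.

(** Near [(A, y)], write [A' y' = (A' - A) y' + A y']: the first term is at most [|A' - A| * |y'|],
    which tends to 0, and the second tends to [A y]. *)
Lemma bop_apply_continuous :
  continuous (fun p : bounded_operator Y V * Y => bop_apply p.1 p.2).
Proof.
move=> [A y]; rewrite /continuous_at /=.
have -> : (fun p : bounded_operator Y V * Y => bop_apply p.1 p.2) =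
    (fun p => bop_apply (p.1 - A) p.2) \+ (fun p => A p.2).
  apply/funext => p; rewrite /= /bop_apply; apply/eqP.
  by rewrite -subr_eq -[_ - _]/((p.1 - A) p.2).
rewrite -[X in _ --> X]add0r; apply: cvgD; last first.
  by apply: continuous_cvg; [exact: bop_continuous|exact: cvg_snd].
apply/norm_cvg0P.
apply: (@squeeze_cvgr _ _ _ _ (cst 0) (fun p => `|p.1 - A| * `|p.2|)).
- by apply: nearW => p; rewrite normr_ge0 ler_bop_norm.
- exact: cvg_cst.
- rewrite -[X in _ --> X](mul0r `|y|).
  apply: cvgM; last by apply: cvg_norm; exact: cvg_snd.
  apply/norm_cvg0P/subr_cvg0; exact: cvg_fst.
Qed.

Lemma is_diff_bop_apply (U : normedModType R) (M : U -> bounded_operator Y V)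
    (F : U -> Y) (u : U) :
  differentiable M u -> differentiable F u ->
  is_diff u (fun v => M v (F v)) (fun x => M u ('d F u x) + ('d M u x) (F u)).
Proof.
move=> dM dF.
have dMF := is_diff_pair (differentiableP dM) (differentiableP dF).
have dap : is_diff (M u, F u) (fun q => bop_apply q.1 q.2)
    (fun q => bop_apply (M u) q.2 + bop_apply q.1 (F u)).
  apply: DiffDef.
    exact: differentiable_bilin bop_apply_continuous.
  by rewrite diff_bilin//; exact: bop_apply_continuous.
exact: (is_diff_comp dMF dap).
Qed.

Lemma frechet_bop_apply (U : normedModType R) (M : U -> bounded_operator Y V)
    (F : U -> Y) (u x : U) :
  differentiable M u -> differentiable F u ->
  frechet (fun v => M v (F v)) u x =
    M u (frechet F u x) + (frechet M u x) (F u).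
Proof.
move=> dM dF; have dG := is_diff_bop_apply dM dF.
by rewrite !frechetE// diff_val.
Qed.

End OperatorApplication.

(** * Bounds and Lipschitz constants for the deflated derivative *)

(** On a bounded set the Lipschitz derivative is bounded; by convexity this makes [f] Lipschitz,
    hence bounded as well. A single constant for all four estimates lets the lemma serve both [F]
    and [M]. *)
Lemma lipschitz_frechet_bounds (R : realType) (U V : normedModType R)
    (f : U -> V) (E : set U) (K : R) :
  convex_set E -> bounded_set E -> (forall u, E u -> differentiable f u) ->
  (forall u v, E u -> E v -> `|frechet f u - frechet f v| <= K * `|u - v|) ->
  exists C : R, forall u v, E u -> E v ->
    [/\ `|f u| <= C, `|frechet f u| <= C, `|f u - f v| <= C * `|u - v|
      & `|frechet f u - frechet f v| <= C * `|u - v|].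
Proof.
move=> cE bE df f'K.
have [E0|/set0P[u0 Eu0]] := eqVneq E set0; first by exists 0 => u v; rewrite E0.
have [b b0 Eb] : exists2 b : R, 0 < b & forall u, E u -> `|u| <= b.
  by move/pinfty_ex_gt0 : bE => [b b0 Eb]; exists b.
have diam u : E u -> `|u - u0| <= 2 * b.
  by move=> Eu; have := ler_normB u u0; have := Eb _ Eu; have := Eb _ Eu0; lra.
(* [K] has no assumed sign; a nonnegative constant is needed to multiply the diameter bound [2 * b]
   and to be absorbed in the final sum. *)
pose K1 := Num.max K 0; have K10 : 0 <= K1 by rewrite le_max lexx orbT.
have f'K1 u v : E u -> E v -> `|frechet f u - frechet f v| <= K1 * `|u - v|.
  move=> Eu Ev; apply: le_trans (f'K _ _ Eu Ev) _.
  by rewrite ler_wpM2r// le_max lexx.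
pose C1 := `|frechet f u0| + K1 * (2 * b).
have Kb0 : 0 <= K1 * (2 * b) by rewrite mulr_ge0//; lra.
have C10 : 0 <= C1 by rewrite /C1 addr_ge0.
have f'C1 u : E u -> `|frechet f u| <= C1.
  move=> Eu; rewrite -(subrK (frechet f u0) (frechet f u)) addrC.
  apply: le_trans (ler_normD _ _) _; rewrite lerD2l.
  by apply: le_trans (f'K1 _ _ Eu Eu0) _; rewrite ler_wpM2l// diam.
have fC1 := lipschitz_of_frechet_bound cE df f'C1.
pose C2 := `|f u0| + C1 * (2 * b).
have Cb0 : 0 <= C1 * (2 * b) by rewrite mulr_ge0//; lra.
have C20 : 0 <= C2 by rewrite /C2 addr_ge0.
have fC2 u : E u -> `|f u| <= C2.
  move=> Eu; rewrite -(subrK (f u0) (f u)) addrC.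
  apply: le_trans (ler_normD _ _) _; rewrite lerD2l.
  by apply: le_trans (fC1 _ _ Eu Eu0) _; rewrite ler_wpM2l// diam.
exists (C1 + C2 + K1) => u v Eu Ev; split.
- by have := fC2 _ Eu; lra.
- by have := f'C1 _ Eu; lra.
- by apply: le_trans (fC1 _ _ Eu Ev) _; rewrite ler_wpM2r//; lra.
- by apply: le_trans (f'K1 _ _ Eu Ev) _; rewrite ler_wpM2r//; lra.
Qed.

Lemma ler_bop_normM (R : realType) (U V : normedModType R)
    (A : bounded_operator U V) (x : U) (r s : R) :
  `|A| <= r -> `|x| <= s -> `|A x| <= r * s.
Proof.
by move=> Ar xs; apply: le_trans (ler_opnorm A x) _; rewrite ler_pM ?opnorm_ge0.
Qed.

(** By the product rule, [G'(u) - G'(v)] telescopes into four terms, each changing only one of [M],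
    [F'], [M'], [F] between [u] and [v]. Each is at most [C * K * |u - v|] on the unit ball, whence
    the factor 4. *)
Lemma frechet_bop_apply_lipschitz (R : realType) (U Y V : normedModType R)
    (M : U -> bounded_operator Y V) (F : U -> Y) (E : set U) (C K : R) :
  (forall u, E u -> differentiable M u) ->
  (forall u, E u -> differentiable F u) ->
  (forall u v, E u -> E v ->
    [/\ `|M u| <= C, `|frechet M u| <= C, `|M u - M v| <= C * `|u - v|
      & `|frechet M u - frechet M v| <= C * `|u - v|]) ->
  (forall u v, E u -> E v ->
    [/\ `|F u| <= K, `|frechet F u| <= K, `|F u - F v| <= K * `|u - v|
      & `|frechet F u - frechet F v| <= K * `|u - v|]) ->
  let G := fun u => M u (F u) in
  forall u v, E u -> E v ->
    `|frechet G u - frechet G v| <= 4 * (C * K) * `|u - v|.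
Proof.
move=> dM dF MC FC G u v Eu Ev.
have [Mu M'u Muv M'uv] := MC _ _ Eu Ev; have [Mv M'v _ _] := MC _ _ Ev Eu.
have [Fu F'u Fuv F'uv] := FC _ _ Eu Ev.
apply: opnorm_le => x x1.
rewrite -[_ x]/(frechet G u x - frechet G v x).
rewrite !frechet_bop_apply; [|exact: dM|exact: dF|exact: dM|exact: dF].
have -> : M u (frechet F u x) + frechet M u x (F u) -
    (M v (frechet F v x) + frechet M v x (F v)) =
  ((M u - M v) (frechet F u x) + M v ((frechet F u - frechet F v) x)) +
  (((frechet M u - frechet M v) x) (F u) + (frechet M v x) (F u - F v)).
  rewrite -[(M u - M v) _]/(M u (frechet F u x) - M v (frechet F u x)).
  rewrite -[(frechet F u - _) x]/(frechet F u x - frechet F v x).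
  rewrite -[((frechet M u - _) x) _]/(frechet M u x (F u) - frechet M v x (F u)).
  by rewrite !bopB !subrKA opprD addrACA.
have := ler_bop_normM Muv (ler_bop_normM F'u x1).
have := ler_bop_normM Mv (ler_bop_normM F'uv x1).
have := ler_bop_normM (ler_bop_normM M'uv x1) Fu.
have := ler_bop_normM (ler_bop_normM M'v x1) Fuv.
rewrite !mulr1 => h1 h2 h3 h4.
apply: le_trans (ler_normD _ _) _.
apply: le_trans (lerD (ler_normD _ _) (ler_normD _ _)) _.
apply: le_trans (lerD (lerD h4 h3) (lerD h2 h1)) _.
move: `|u - v| => d; rewrite le_eqVlt; apply/orP; left; apply/eqP; ring.
Qed.

(** * Overlapping balls and convergence to both roots *)

Lemma ball_intersection (R : realType) (U : normedModType R) (u v : U) (r s : R) :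
  0 < r -> 0 < s -> `|u - v| < r + s -> ball u r `&` ball v s !=set0.
Proof.
move=> r0 s0 uv; have rs0 : 0 < r + s by lra.
(* The point dividing the segment from [u] to [v] in the ratio [r : s]. *)
exists (u - (r / (r + s)) *: (u - v)); rewrite -!ball_normE; split => /=.
  rewrite opprB addrCA subrr addr0 normrZ gtr0_norm ?divr_gt0//.
  by rewrite mulrAC ltr_pdivrMr// ltr_pM2l.
rewrite opprB addrCA -[v - u]opprB -[X in _ - X]scale1r -scalerBl.
have -> : r / (r + s) - 1 = - (s / (r + s)) by field; rewrite gt_eqF.
rewrite scaleNr normrN normrZ gtr0_norm ?divr_gt0//.
by rewrite mulrAC ltr_pdivrMr// ltr_pM2l.
Qed.

Theorem theorem3p5 (R : realType) (U Y : completeNormedModType R)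
  (isoUY : exists T : bounded_operator U Y, bop_invertible T)
  (D : set U) (openD : open D)
  (F : U -> Y) (F_C1 : continuously_differentiable_on D F)
  (u1 u2 : U) (Du1 : D u1) (Du2 : D u2)
  (Fu1 : F u1 = 0) (Fu2 : F u2 = 0) (u1_neq_u2 : u1 <> u2)
  (E1 : set U) (openE1 : open E1) (boundedE1 : bounded_set E1)
  (convexE1 : convex_set E1) (E1D : E1 `<=` D `\ u2) (E1u1 : E1 u1)
  (E2 : set U) (openE2 : open E2) (boundedE2 : bounded_set E2)
  (convexE2 : convex_set E2) (E2D : E2 `<=` D `\ u1) (E2u2 : E2 u2)
  (M : U -> bounded_operator Y Y) (defM : deflation_operator D F u1 M)
  (w1 w2 wM : R) (w1_gt0 : 0 < w1) (w2_gt0 : 0 < w2) (wM_gt0 : 0 < wM)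
  (F'u1_inv : bop_invertible (frechet F u1))
  (F'u2_inv : bop_invertible (frechet F u2))
  (F'_lip1 : forall u v, E1 u -> E1 v ->
    `|bop_comp (bop_inv (frechet F u1)) (frechet F u - frechet F v)|
      <= w1 * `|u - v|)
  (F'_lip2 : forall u v, E2 u -> E2 v ->
    `|bop_comp (bop_inv (frechet F u2)) (frechet F u - frechet F v)|
      <= w2 * `|u - v|)
  (M_C1 : continuously_differentiable_on E2 M)
  (M'_lip : forall u v, E2 u -> E2 v ->
    `|frechet M u - frechet M v| <= wM * `|u - v|) :
  let G := fun u => M u (F u) in
  let G'_lip := fun w : R => forall u v, E2 u -> E2 v ->
    `|bop_comp (bop_inv (frechet G u2)) (frechet G u - frechet G v)|
      <= w * `|u - v| in
  [/\ forall u, E2 u -> differentiable G u,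
      bop_invertible (frechet G u2),
      exists w : R, 0 < w /\ G'_lip w
    & forall w : R, 0 < w -> G'_lip w ->
      forall rho1 rho2 : R,
        rho1 <= 2 / (3 * w1) -> rho2 <= 2 / (3 * w) ->
        ball u1 rho1 `<=` E1 -> ball u2 rho2 `<=` E2 ->
        `|u1 - u2| < rho1 + rho2 ->
        ball u1 rho1 `&` ball u2 rho2 !=set0 /\
        forall u0, (ball u1 rho1 `&` ball u2 rho2) u0 ->
          newton_converges D F u0 u1 /\
          newton_converges (D `\ u1) G u0 u2].
Proof.
move=> G G'_lip.
have E1u2 : ~ E1 u2 by move=> /E1D[_]; apply.
have E2u1 : ~ E2 u1 by move=> /E2D[_]; apply.
have dF u : D u -> differentiable F u by exact: F_C1.1.
have dF2 u : E2 u -> differentiable F u by move=> /E2D[/dF].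
have dM u : E2 u -> differentiable M u by exact: M_C1.1.
have dG u : E2 u -> differentiable G u.
  by move=> Eu; have [] := is_diff_bop_apply (dM _ Eu) (dF2 _ Eu).
(* Composing with [F'(u2)] undoes the normalisation, giving a Lipschitz bound for [F'] itself. *)
have F'_lip u v : E2 u -> E2 v ->
    `|frechet F u - frechet F v| <= `|frechet F u2| * w2 * `|u - v|.
  move=> Eu Ev; rewrite -mulrA.
  have -> : frechet F u - frechet F v = bop_comp (frechet F u2)
      (bop_comp (bop_inv (frechet F u2)) (frechet F u - frechet F v)).
    by apply: bopP => x; exact/esym/(bop_invP F'u2_inv).2.
  by apply: le_trans (bop_norm_comp _ _) _; rewrite ler_wpM2l// F'_lip2.
have [CF FC] := lipschitz_frechet_bounds convexE2 boundedE2 dF2 F'_lip.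
have [CM MC] := lipschitz_frechet_bounds convexE2 boundedE2 dM M'_lip.
have G'C := frechet_bop_apply_lipschitz dM dF2 MC FC.
have G'inv : bop_invertible (frechet G u2).
  have -> : frechet G u2 = bop_comp (M u2) (frechet F u2).
    apply: bopP => x; rewrite frechet_bop_apply ?Fu2; [|exact: dM|exact: dF2].
    by rewrite linear0 addr0.
  by apply: bop_invertible_comp => //; apply: defM.1; exact: E2D.
split; [exact: dG|exact: G'inv| |].
  pose B := bop_inv (frechet G u2).
  (* The added 1 makes the constant strictly positive; the inner absolute value is there because
     [CM] and [CF] come without a sign. *)
  exists (`|B| * `|4 * (CM * CF)| + 1); split.
    by rewrite ltr_wpDl// mulr_ge0.
  move=> u v Eu Ev; apply: le_trans (bop_norm_comp _ _) _.
  rewrite mulrDl mul1r -mulrA -[leLHS]addr0 lerD// ler_wpM2l//.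
  by apply: le_trans (G'C _ _ Eu Ev) _; rewrite ler_wpM2r// ler_norm.
move=> w w_gt0 Gw rho1 rho2 rho1w rho2w B1 B2 r12.
(* Positivity of the radii is derived: if [rho1 <= 0], then [|u1 - u2| < rho2] puts [u1] in the
   second ball, hence in [E2], which excludes it. The argument for [rho2] is symmetric. *)
have rho1_gt0 : 0 < rho1.
  rewrite ltNge; apply/negP => r10; apply/E2u1/B2; rewrite -ball_normE /= distrC.
  by apply: lt_le_trans r12 _; rewrite gerDr.
have rho2_gt0 : 0 < rho2.
  rewrite ltNge; apply/negP => r20; apply/E1u2/B1; rewrite -ball_normE /=.
  by apply: lt_le_trans r12 _; rewrite gerDl.
split; first exact: ball_intersection.
move=> u0 [u01 u02]; split.
- apply: (newton_local_convergence w1_gt0 rho1w Fu1) u01 => //.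
  + by move=> u /B1/E1D[/dF].
  + by move=> u v /B1 Eu /B1 Ev; exact: F'_lip1.
  + by move=> u /B1/E1D[].
- apply: (newton_local_convergence w_gt0 rho2w _) u02 => //.
  + by rewrite /G Fu2 linear0.
  + by move=> u /B2/dG.
  + by move=> u v /B2 Eu /B2 Ev; exact: Gw.
  + by move=> u /B2/E2D.
Qed.
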